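(* Let $a\ge 1$ be a real number, let $\xi$ be a nonnegative random variable with all moments $\mathbf{E}[\xi^k]$, $k=1,2,\ldots$, finite and $\mathbf{E}[\xi]>0$, let $\xi_1,\xi_2,\ldots,\xi_{\lfloor a\rfloor}$ be independent copies of $\xi$, and let $Y_{\lfloor a\rfloor}=\xi_1\xi_2\cdots\xi_{\lfloor a\rfloor}$. If $$\frac{\mathbf{E}[\xi^{k+1}]}{\mathbf{E}[\xi^k]}=\mathcal{O}((k+1)^{2/a})\quad\text{as } k\to\infty,$$ then $Y_{\lfloor a\rfloor}$ satisfies Carleman's condition, $\sum_{k=1}^{\infty}\left(\mathbf{E}[Y_{\lfloor a\rfloor}^k]\right)^{-1/(2k)}=\infty$, and $Y_{\lfloor a\rfloor}$ is M-det.
   Context: For a real number $a$, $\lfloor a\rfloor$ is the largest integer less than or equal to $a$. A nonnegative random variable with all moments finite is called M-det (moment determinate, in the sense of the Stieltjes moment problem) if its distribution is the only probability distribution on $[0,\infty)$ having its moment sequence. *)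

(* Defs.v *)
From mathcomp Require Export all_boot all_order all_algebra.
From mathcomp Require Export all_classical all_reals all_analysis.
Set Implicit Arguments.
Unset Strict Implicit.
Unset Printing Implicit Defensive.
Import Order.TTheory GRing.Theory Num.Theory.
Import numFieldNormedType.Exports.
Local Open Scope classical_set_scope.
Local Open Scope ring_scope.

Definition moment (d : measure_display) (T : measurableType d) (R : realType)
    (P : probability T R) (X : T -> R) (k : nat) : \bar R :=
  'E_P[fun t => X t ^+ k].

Definition nonnegative_rv (d : measure_display) (T : measurableType d)
    (R : realType) (P : probability T R) (X : {RV P >-> R}) : Prop :=
  {ae P, forall t, 0 <= X t}.

Definition finite_moments (d : measure_display) (T : measurableType d)
    (R : realType) (P : probability T R) (X : {RV P >-> R}) : Prop :=
  forall k : nat, moment P X k \is a fin_num.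

Definition mutually_independent (d : measure_display) (T : measurableType d)
    (R : realType) (P : probability T R) (I : finType)
    (X : I -> {RV P >-> R}) : Prop :=
  forall (J : {set I}) (A : I -> set R), (forall i, measurable (A i)) ->
    P (\bigcap_(i in [set` J]) (X i @^-1` A i))
    = (\prod_(i in J) P (X i @^-1` A i))%E.

(* The variables of the family may live on another space than [Z]. *)
Definition independent_copies (d d' : measure_display) (T : measurableType d)
    (T' : measurableType d') (R : realType) (P : probability T R)
    (P' : probability T' R) (Z : {RV P >-> R}) (I : finType)
    (X : I -> {RV P' >-> R}) : Prop :=
  mutually_independent X /\
  forall (i : I) (A : set R), measurable A ->
    distribution P' (X i) A = distribution P Z A.

(* [fine] and [powR] are total with [powR 0 r = 0] for [r < 0]: a null or
   infinite moment would contribute [0] to the series. *)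
Definition carleman (d : measure_display) (T : measurableType d)
    (R : realType) (P : probability T R) (X : {RV P >-> R}) : Prop :=
  (\sum_(1 <= k <oo)
     (fine (moment P X k) `^ (- (1 / (2 * k%:R))))%:E = +oo)%E.

(* Measures are functions on all sets, so two laws are equal when they agree
   on the measurable ones. *)
Definition M_det (d : measure_display) (T : measurableType d)
    (R : realType) (P : probability T R) (X : {RV P >-> R}) : Prop :=
  [/\ nonnegative_rv X, finite_moments X &
      forall nu : probability R R,
        nu `[0, +oo[%classic = 1%E ->
        (forall k : nat, (\int[nu]_x (x ^+ k)%:E)%E = moment P X k) ->
        forall A : set R, measurable A -> nu A = distribution P X A].

(* Main.v *)
Require Import Defs.
From mathcomp Require Import measurable_realfun.
From mathcomp Require Import ring lra.
Set Implicit Arguments.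
Unset Strict Implicit.
Unset Printing Implicit Defensive.
Import Order.TTheory GRing.Theory Num.Theory.
Import numFieldNormedType.Exports.
Local Open Scope classical_set_scope.
Local Open Scope ring_scope.

(** Write [N] for the integer part of [a], [m k] for the [k]-th moment of
    [xi] and [y k] for that of [Y]. Multiplying the ratios gives
    [m k <= C ^ k * (k!) ^ (2 / a)] ([growth_of_ratio]), and by independence
    [y k = m k ^ N] ([moment_product]); since [N <= a] the exponents cancel:
    [y k <= D ^ k * (k!) ^ 2] with [D = C ^ N] ([growth_exprn]). Carleman's
    series then dominates a multiple of the harmonic series
    ([carleman_series]).

    For the determinacy, [(k!) ^ 2 <= (2 k)!], so the same bound gives [sqrt Y]
    an exponential moment (Hardy's condition, [hardy_M_det]). Let [mu] and
    [nu] be laws on the half-line with the same moments, let [y = sqrt x], and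
    consider the functions whose integrals under [mu] and [nu] exist and agree
    ([same_int]). The even powers of [y] are among them. Taylor's formula for
    cosine, integrated termwise thanks to the exponential moment, shows that if
    all the derivatives in [t] of [cos (t y)] are among them at some [t], then
    so are they at [t + h] for [h] below a fixed radius ([same_trig_shift]).
    Steps of that size reach every real [t] from [t = 0], where the derivatives
    are the even powers of [y] up to sign, or zero.

    So [cos (t y)] qualifies for every [t], hence so does every polynomial in
    [cos (t y)], because a product of cosines is a sum of cosines; hence so does
    the indicator of [cos (t y) > cos (t b)], a bounded limit of such
    polynomials ([cvg_threshold], [same_int_threshold]). When [t] tends to [0],
    both [t y] and [t b] end up in the interval [[0, pi]], where cosine
    decreases, and the indicator becomes that of [y < b]
    ([same_measure_ball]). The sets [y < b] determine the law of [x]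
    ([stieltjes_determinacy]). *)

(** * Polynomial approximation of a threshold *)

Section Threshold.
Context (R : realType).

Lemma bernoulli_ge (x : R) (n : nat) : -1 <= x -> 1 + n%:R * x <= (1 + x) ^+ n.
Proof.
move=> x1; elim: n => [|n IH]; first by rewrite mul0r addr0 expr0.
rewrite exprS (le_trans _ (ler_wpM2l _ IH))//; last by lra.
rewrite -natr1; have := ler0n R n; nra.
Qed.

Lemma cvg_mul_expr0 (q : R) : 0 <= q -> q < 1 ->
  (fun n : nat => n%:R * q ^+ n) @ \oo --> 0.
Proof.
move=> q0 q1.
have [->|qn0] := eqVneq q 0.
  apply: cvg_near_cst; exists 1%N => // n /= n1.
  by rewrite expr0n gtn_eqF// mulr0.
have qgt : 0 < q by rewrite lt_neqAle eq_sym qn0.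
(* Write q = s^2: Bernoulli for 1/s bounds n s^n by 1 / (1/s - 1), and the
   other factor s^n tends to 0. *)
set s := Num.sqrt q.
have s0 : 0 < s by rewrite sqrtr_gt0.
have s1 : s < 1 by rewrite -sqrtr1 ltr_sqrt.
have sq : s ^+ 2 = q by rewrite sqr_sqrtr.
have b : 0 < s^-1 - 1 by rewrite subr_gt0 invf_gt1.
have bnd n : n%:R * s ^+ n <= (s^-1 - 1)^-1.
  rewrite -ler_pdivlMr ?exprn_gt0// -exprVn.
  rewrite ler_pdivlMl//.
  have := @bernoulli_ge (s^-1 - 1) n; rewrite addrCA subrr addr0 => H.
  by have := H ltac:(lra); lra.
apply: (@squeeze_cvgr _ _ _ _ (fun=> 0) (fun n => (s^-1 - 1)^-1 * s ^+ n)).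
- near=> n; rewrite mulr_ge0 ?exprn_ge0//=.
  rewrite -sq -exprM mulnC exprM expr2 mulrA ler_wpM2r ?exprn_ge0// ?bnd// ltW//.
- exact: cvg_cst.
- rewrite -[X in _ --> X](mulr0 (s^-1 - 1)^-1).
  by apply: cvgMr; apply: cvg_expr; rewrite ger0_norm // ltW.
Unshelve. all: by end_near. Qed.

(** These polynomials in [v] take values in [[0, 1]]. By Bernoulli's inequality
    they are at least [1 - n (2 v) ^ n], and at most [1 / (1 + n (2 v) ^ n)].
    The extra factor [n] in the exponent makes the limit [0] at [v = 1/2] too,
    where [(1 - v ^ n) ^ (2 ^ n)] would tend to [1 / e]. *)
Lemma cvg_threshold (v : R) : 0 <= v <= 1 ->
  (fun n : nat => (1 - v ^+ n) ^+ (n * 2 ^ n)) @ \oo --> ((v < 2^-1)%R%:R : R).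
Proof.
move=> /andP[v0 v1].
have vn n : 0 <= v ^+ n <= 1 by rewrite exprn_ge0// exprn_ile1.
have [v2|v2] := ltP v (2^-1 : R).
- apply: (@squeeze_cvgr _ _ _ _ (fun n => 1 - n%:R * (2 * v) ^+ n) (fun=> 1)).
  + near=> n; have /andP[a b] := vn n; apply/andP; split; last first.
      by rewrite exprn_ile1//; lra.
    have := @bernoulli_ge (- v ^+ n) (n * 2 ^ n).
    rewrite natrM natrX exprMn => H; have := H ltac:(lra); lra.
  + rewrite -[X in _ --> X]subr0; apply: cvgB; first exact: cvg_cst.
    by apply: cvg_mul_expr0; lra.
  + exact: cvg_cst.
- apply: (@squeeze_cvgr _ _ _ _ (fun=> 0) (@harmonic R)).
  + near=> n; have /andP[a b] := vn n; apply/andP; split.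
      by rewrite exprn_ge0//; lra.
    rewrite /harmonic/= -[leRHS]mul1r ler_pdivlMr ?ltr0n//.
    (* With w = v^n >= 2^-n and m = n 2^n, the upper bound comes from
       (1 - w)^m (1 + w)^m <= 1 and 1 + n <= 1 + m w <= (1 + w)^m. *)
    have h1 : n.+1%:R <= (1 + v ^+ n) ^+ (n * 2 ^ n).
      apply: le_trans (@bernoulli_ge (v ^+ n) (n * 2 ^ n) _); last by lra.
      rewrite natrM natrX -mulrA -exprMn -natr1 addrC lerD2l.
      rewrite ler_peMr ?ler0n// exprn_ege1//; lra.
    apply: le_trans (ler_wpM2l _ h1) _; first by rewrite exprn_ge0//; lra.
    by rewrite -exprMn exprn_ile1//; nra.
  + exact: cvg_cst.
  + exact: cvg_harmonic.
Unshelve. all: by end_near. Qed.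

End Threshold.

(** * Functions with the same integral under two laws *)

Section SameIntegral.
Context d (T : measurableType d) (R : realType) (mu nu : probability T R).

Definition same_int (f : T -> R) : Prop :=
  [/\ mu.-integrable setT (EFin \o f), nu.-integrable setT (EFin \o f) &
      (\int[mu]_x (f x)%:E = \int[nu]_x (f x)%:E)%E].

Lemma same_int_meas f : same_int f -> measurable_fun setT f.
Proof.
by move=> [/measurable_int/measurable_EFinP].
Qed.

Lemma eq_same_int f g : f =1 g -> same_int f -> same_int g.
Proof. by move=> /funext ->. Qed.

Lemma same_int_cst (c : R) : same_int (cst c).
Proof.
split; [exact: finite_measure_integrable_cst..|].
rewrite (integral_cst mu measurableT c%:E) (integral_cst nu measurableT c%:E).
by congr (_ * _)%E; rewrite [LHS]probability_setT [RHS]probability_setT.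
Qed.

Lemma same_intD f g : same_int f -> same_int g ->
  same_int (fun x => f x + g x).
Proof.
move=> [f1 f2 f3] [g1 g2 g3]; split.
- exact: (integrableD _ f1 g1).
- exact: (integrableD _ f2 g2).
- under eq_integral do rewrite EFinD; under [RHS]eq_integral do rewrite EFinD.
  by rewrite (integralD _ f1 g1)// (integralD _ f2 g2)//= f3 g3.
Qed.

Lemma same_intZ c f : same_int f -> same_int (fun x => c * f x).
Proof.
move=> [f1 f2 f3]; split.
- exact: (integrableZl _ c f1).
- exact: (integrableZl _ c f2).
- under eq_integral do rewrite EFinM; under [RHS]eq_integral do rewrite EFinM.
  by rewrite (integralZl _ f1)// (integralZl _ f2)//= f3.
Qed.

Lemma same_int_sum (I : Type) (s : seq I) (F : I -> T -> R) :
  (forall i, same_int (F i)) -> same_int (fun x => \sum_(i <- s) F i x).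
Proof.
move=> H; elim: s => [|i s IH].
  by apply: eq_same_int (same_int_cst 0) => x; rewrite big_nil.
by apply: eq_same_int (same_intD (H i) IH) => x; rewrite big_cons.
Qed.

Lemma same_int_cvg (f_ : nat -> T -> R) (f g : T -> R) :
  (forall n, same_int (f_ n)) ->
  (forall x, f_ n x @[n --> \oo] --> f x) ->
  (forall n x, `|f_ n x| <= g x) ->
  mu.-integrable setT (EFin \o g) -> nu.-integrable setT (EFin \o g) ->
  same_int f.
Proof.
move=> sf ff fg gm gn.
have mf_ n : measurable_fun setT (EFin \o f_ n).
  exact/measurable_EFinP/same_int_meas/sf.
have mf : measurable_fun setT (EFin \o f).
  apply/measurable_EFinP; apply: (@measurable_fun_cvg _ _ _ _ f_); last by move=> x _; exact: ff.
  by move=> n; exact: same_int_meas.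
have ffE x : setT x -> (EFin \o f_ n) x @[n --> \oo] --> (EFin \o f) x.
  by move=> _; apply: cvg_EFin; [exact: nearW|exact: ff].
have fgE n x : setT x -> (`|(EFin \o f_ n) x| <= (EFin \o g) x)%E.
  by move=> _; rewrite lee_fin fg.
have [i1 _ c1] := dominated_convergence measurableT mf_ mf (aeW mu ffE) gm
  (aeW mu (fun x n => fgE n x)).
have [i2 _ c2] := dominated_convergence measurableT mf_ mf (aeW nu ffE) gn
  (aeW nu (fun x n => fgE n x)).
split => //; apply: (cvg_unique _ c1) => //.
apply: cvg_trans c2; apply: near_eq_cvg; near=> n => /=.
by have [_ _ ->] := sf n.
Unshelve. all: by end_near. Qed.

Lemma same_int_measure (A : set T) : measurable A ->
  same_int (\1_A) -> mu A = nu A.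
Proof.
by move=> mA [_ _]; rewrite !integral_indic// setIT.
Qed.

(** Having the same moments, the bounded variable [u] has the same expectation
    of [p (u)] under both laws for every polynomial [p]; the affine function
    [v = 1/2 + (c - u) / 4] maps [[-1, 1]] into [[0, 1]] and is below [1/2]
    exactly when [u > c], so [cvg_threshold] applies. *)
Lemma same_int_threshold (u : T -> R) (c : R) :
  (forall x, `|u x| <= 1) -> `|c| <= 1 ->
  (forall n, same_int (fun x => u x ^+ n)) ->
  same_int (fun x => (c < u x)%R%:R).
Proof.
move=> u1 c1 un.
have poly (p : {poly R}) : same_int (fun x => p.[u x]).
  have := same_int_sum (index_enum 'I_(size p)) (fun i => same_intZ p`_i (un i)).
  by apply: eq_same_int => x; rewrite horner_coef.
pose v : {poly R} := (2^-1 + c / 4)%:P - 4^-1 *: 'X.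
have vE x : v.[u x] = 2^-1 + (c - u x) / 4.
  by rewrite /v !hornerE; field.
have v01 x : 0 <= v.[u x] <= 1.
  by rewrite vE; have := u1 x; rewrite !ler_norml in c1 *; lra.
have pE n m x : ((1 - v ^+ n) ^+ m).[u x] = (1 - v.[u x] ^+ n) ^+ m.
  by rewrite horner_exp hornerD hornerN horner_exp -polyC1 hornerC.
apply: (@same_int_cvg (fun n x => ((1 - v ^+ n) ^+ (n * 2 ^ n)).[u x]) _ (cst 1)).
- by move=> n; exact: poly.
- move=> x; have := cvg_threshold (v01 x).
  have -> : (v.[u x] < 2^-1) = (c < u x) by rewrite vE; apply/idP/idP; lra.
  apply: cvg_trans; apply: near_eq_cvg; near=> n.
  by rewrite pE.
- move=> n x; rewrite pE.
  have /andP[a b] := v01 x.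
  have : 0 <= v.[u x] ^+ n <= 1 by rewrite exprn_ge0// exprn_ile1.
  move=> /andP[a' b']; rewrite ger0_norm ?exprn_ile1 ?exprn_ge0//; lra.
- exact: finite_measure_integrable_cst.
- exact: finite_measure_integrable_cst.
Unshelve. all: by end_near. Qed.

End SameIntegral.

(** * Taylor expansion of sine and cosine *)

Section TrigTaylor.
Context (R : realType).
Implicit Types (b : bool) (z w : R).

(** One name for both functions, so that the [m]-th derivative in [t] of
    [cos (t y)] is [y ^ m * trig (odd m) (t y)] up to sign. *)
Definition trig b z : R := if b then sin z else cos z.

(** The term of degree [j] in [w] of the expansion of [trig b (z + w)] at [z]:
    the addition formula with the power series of [cos w] and [sin w]. *)
Definition taylor b z w (j : nat) : R :=
  trig b z * cos_coeff w j + (-1) ^+ (~~ b) * trig (~~ b) z * sin_coeff w j.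

Lemma trig_le1 b z : `|trig b z| <= 1.
Proof. by case: b; [exact: sin_max|exact: cos_max]. Qed.

Lemma cvg_taylor b z w : series (taylor b z w) @ \oo --> trig b (z + w).
Proof.
have -> : series (taylor b z w) = (fun n => trig b z * series (cos_coeff w) n +
    (-1) ^+ (~~ b) * trig (~~ b) z * series (sin_coeff w) n).
  by apply/funext => n; rewrite /series/= !mulr_sumr -big_split.
have -> : trig b (z + w) =
    trig b z * cos w + (-1) ^+ (~~ b) * trig (~~ b) z * sin w.
  by case: b; rewrite /= ?sinD ?cosD ?expr0 ?expr1 ?mul1r ?mulN1r ?mulNr.
apply: cvgD; apply: cvgMr.
- by rewrite unlock; exact: is_cvg_series_cos_coeff.
- by rewrite unlock; exact: is_cvg_series_sin_coeff.
Qed.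

Lemma exp_coeff_norm_cos_coeff w j : `|cos_coeff w j| <= exp_coeff `|w| j.
Proof.
rewrite /exp_coeff /cos_coeff/= -exprnP.
rewrite !normrM normfV !normr_nat !normrX normrN normr1 expr1n mulr1.
by case: odd; rewrite ?mul1r// !mul0r mulr_ge0.
Qed.

Lemma exp_coeff_norm_sin_coeff w j : `|sin_coeff w j| <= exp_coeff `|w| j.
Proof.
rewrite /exp_coeff /sin_coeff/=.
rewrite !normrM normfV !normr_nat !normrX normrN normr1 expr1n mulr1.
by case: odd; rewrite ?mul1r// !mul0r mulr_ge0.
Qed.

Lemma series_exp_coeff_le w n : 0 <= w -> series (exp_coeff w) n <= expR w.
Proof.
move=> w0; apply: nondecreasing_cvgn_le; last exact: is_cvg_series_exp_coeff.
by apply: nondecreasing_series => i _ _; exact: exp_coeff_ge0.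
Qed.

Lemma taylor_le b z w n : `|series (taylor b z w) n| <= 2 * expR `|w|.
Proof.
apply: (@le_trans _ _ (2 * series (exp_coeff `|w|) n)); last first.
  by rewrite ler_wpM2l// series_exp_coeff_le.
rewrite /series/= mulr_sumr (le_trans (ler_norm_sum _ _ _))//.
apply: ler_sum => j _; rewrite /taylor (le_trans (ler_normD _ _))//.
have h1 : `|trig b z * cos_coeff w j| <= exp_coeff `|w| j.
  rewrite normrM -[leRHS]mul1r ler_pM ?trig_le1//.
  exact: exp_coeff_norm_cos_coeff.
have h2 : `|(-1) ^+ (~~ b) * trig (~~ b) z * sin_coeff w j| <= exp_coeff `|w| j.
  rewrite normrM -[leRHS]mul1r ler_pM ?exp_coeff_norm_sin_coeff//.
  by rewrite normrM normr_sign mul1r trig_le1.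
by rewrite mulr_natl mulr2n lerD.
Qed.

(** The sign is that of the [j]-th derivative of sine or cosine. *)
Definition taylor_cst (m j : nat) w : R :=
  (if odd j then (-1) ^+ (~~ odd m) * (-1) ^+ j.-1./2 else (-1) ^+ j./2) *
    w ^+ j / j`!%:R.

(** The functions [y ^ m * trig (odd m) (t y)] are stable under termwise
    expansion: a term of degree [j] has the parity of [m + j], since a cosine
    turns into a sine, or conversely, exactly when [j] is odd. *)
Lemma taylorE z w y m j : y ^+ m * taylor (odd m) z (w * y) j =
    taylor_cst m j w * (y ^+ (m + j) * trig (odd (m + j)) z).
Proof.
rewrite /taylor /taylor_cst /cos_coeff /sin_coeff /= oddD exprD exprMn -exprnP.
case: (odd j); rewrite /= ?mul1r ?mul0r ?mulr0 ?addr0 ?add0r.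
  by rewrite addbT; ring.
by rewrite addbF; ring.
Qed.

Lemma exprn_le_expR (x : R) m : 0 <= x -> x ^+ m <= m`!%:R * expR x.
Proof.
move=> x0; rewrite -ler_pdivrMl ?ltr0n ?fact_gt0// mulrC.
case: m => [|m]; first by rewrite expr0 fact0 divr1 -expR0 ler_expR.
by apply: le_trans (expR_ge1Dxn _ x0); lra.
Qed.

End TrigTaylor.

(** * Exponential moments *)

Section ExponentialMoment.
Context d (T : measurableType d) (R : realType) (mu : probability T R).
Context (y : T -> R) (K : R).
Hypotheses (my : measurable_fun setT y) (K0 : 0 < K).
Hypothesis ymom :
  forall k, (\int[mu]_x (y x ^+ k.*2)%:E <= (K ^+ k.*2 * k.*2`!%:R)%:E)%E.

(** The power series of [2 cosh], which involves the even moments only and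
    dominates the exponential of the absolute value. *)
Let cosh_coeff (w : R) (i : nat) : R := exp_coeff w i + exp_coeff (- w) i.

Let cosh_coeffE w i : cosh_coeff w i = (~~ odd i)%:R * (2 * w ^+ i / i`!%:R).
Proof.
rewrite /cosh_coeff /exp_coeff/= exprNn -signr_odd.
by case: odd; rewrite /= ?expr0 ?expr1; ring.
Qed.

Let cosh_coeff_ge0 w i : 0 <= cosh_coeff w i.
Proof.
rewrite cosh_coeffE; case: (boolP (odd i)) => oi; first by rewrite mul0r.
by rewrite mul1r mulr_ge0// mulr_ge0// exprn_even_ge0.
Qed.

Let cvg_cosh w : series (cosh_coeff w) @ \oo --> expR w + expR (- w).
Proof.
have -> : series (cosh_coeff w) =
    (fun n => series (exp_coeff w) n + series (exp_coeff (- w)) n).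
  by apply/funext => n; rewrite /series/= -big_split.
by apply: cvgD; exact: is_cvg_series_exp_coeff.
Qed.

Let integral_cosh_coeff s i : 0 < s -> s * K <= 2^-1 ->
  (\int[mu]_x (cosh_coeff (s * y x) i)%:E <= (2 * 2^-1 ^+ i)%:E)%E.
Proof.
move=> s0 sK; under eq_integral do rewrite cosh_coeffE.
case: (boolP (odd i)) => oi /=.
  under eq_integral do rewrite mul0r.
  by rewrite integral0 lee_fin mulr_ge0// exprn_ge0.
have iE : i = (i./2).*2 by rewrite even_halfK.
have -> : (\int[mu]_x (1 * (2 * (s * y x) ^+ i / i`!%:R))%:E)%E =
    ((2 * s ^+ i / i`!%:R)%:E * \int[mu]_x (y x ^+ i)%:E)%E.
  rewrite -ge0_integralZl//.
  - by apply: eq_integral => x _; rewrite -EFinM exprMn; congr EFin; ring.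
  - by apply/measurable_EFinP; exact: measurable_funX.
  - by move=> x _; rewrite lee_fin exprn_even_ge0.
  - by rewrite lee_fin mulr_ge0// mulr_ge0// exprn_ge0// ltW.
apply: (@le_trans _ _ ((2 * s ^+ i / i`!%:R)%:E * (K ^+ i * i`!%:R)%:E)%E).
  rewrite lee_wpmul2l//; last by have := ymom i./2; rewrite -iE.
  by rewrite lee_fin mulr_ge0// mulr_ge0// exprn_ge0// ltW.
rewrite -EFinM lee_fin.
have -> : 2 * s ^+ i / i`!%:R * (K ^+ i * i`!%:R) = 2 * (s * K) ^+ i.
  by rewrite exprMn; field; rewrite pnatr_eq0 -lt0n fact_gt0.
by rewrite ler_wpM2l// lerXn2r// nnegrE ?mulr_ge0// ltW.
Qed.

(** By monotone convergence, [2 cosh (s y)] has integral at most the sum of the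
    [2 (s K) ^ i], which is at most [4] since [s K <= 1/2]. *)
Lemma integrable_expR_norm s : 0 < s -> s * K <= 2^-1 ->
  mu.-integrable setT (EFin \o (fun x => expR (s * `|y x|))).
Proof.
move=> s0 sK.
have msy : measurable_fun setT (fun x => s * y x).
  by apply: measurable_funM => //; exact: measurable_cst.
have mexp (f : T -> R) : measurable_fun setT f ->
    measurable_fun setT (fun x => expR (f x)).
  by move=> mf; exact: measurableT_comp.
pose f n x : \bar R := (series (cosh_coeff (s * y x)) n)%:E.
have mc i : measurable_fun setT (fun x => cosh_coeff (s * y x) i).
  rewrite /cosh_coeff /exp_coeff/=; apply: measurable_funD.
    apply: measurable_funM; last exact: measurable_cst.
    exact: measurable_funX.
  apply: measurable_funM; last exact: measurable_cst.
  by apply: measurable_funX; exact: measurable_funN.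
have mf n : measurable_fun setT (f n).
  by apply/measurable_EFinP; apply: measurable_sum => i; exact: mc.
have f0 n x : setT x -> (0 <= f n x)%E.
  by move=> _; rewrite lee_fin sumr_ge0.
have ndf x : setT x -> {homo f^~ x : n m / (n <= m)%N >-> (n <= m)%E}.
  move=> _ n m nm; rewrite lee_fin; move: n m nm; apply: nondecreasing_series.
  by move=> i _ _; exact: cosh_coeff_ge0.
have intf n : (\int[mu]_x f n x <= 4%:E)%E.
  rewrite /f /series/=; under eq_integral do rewrite -sumEFin.
  rewrite ge0_integral_sum//; last 2 first.
    by move=> i; exact/measurable_EFinP/mc.
    by move=> i x _; rewrite lee_fin.
  apply: (@le_trans _ _ (\sum_(0 <= i < n) (2 * 2^-1 ^+ i)%:E)%E).
    by apply: lee_sum => i _; exact: integral_cosh_coeff.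
  rewrite sumEFin lee_fin.
  have -> : \sum_(0 <= i < n) (2 * 2^-1 ^+ i : R) = 4 - 4 * 2^-1 ^+ n.
    elim: n => [|n IH]; first by rewrite big_geq// expr0; ring.
    by rewrite big_nat_recr//= IH exprS; field.
  by rewrite lerBlDr lerDl mulr_ge0// exprn_ge0.
apply/integrableP; split; first by apply/measurable_EFinP/mexp/measurable_funM;
  [exact: measurable_cst|exact: measurableT_comp].
apply: (@le_lt_trans _ _ (\int[mu]_x limn (f^~ x))%E).
  apply: ge0_le_integral => //.
  - apply/measurable_EFinP; apply: measurableT_comp => //.
    by apply/mexp/measurable_funM;
      [exact: measurable_cst|exact: measurableT_comp].
  - apply: (emeasurable_fun_cvg f) => // x _.
    by apply: ereal_nondecreasing_is_cvgn => n m nm; exact: (ndf x Logic.I).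
  - move=> x _; have -> : limn (f^~ x) = (expR (s * y x) + expR (- (s * y x)))%:E.
      apply/cvg_lim => //; apply: cvg_EFin; first exact: nearW.
      exact: cvg_cosh.
    rewrite lee_fin ger0_norm ?expR_ge0//.
    by case: (ger0P (y x)) => _; rewrite ?mulrN ?lerDl ?lerDr expR_ge0.
rewrite monotone_convergence//.
apply: (@le_lt_trans _ _ 4%:E); last exact: ltry.
apply: lime_le; last exact: nearW.
apply: ereal_nondecreasing_is_cvgn => n m nm.
by apply: ge0_le_integral => //; [exact: f0|move=> x _; exact: (ndf x Logic.I)].
Qed.

End ExponentialMoment.

(** * Uniqueness for the law of the absolute value *)

Section SymmetricDeterminacy.
Context d (T : measurableType d) (R : realType) (mu nu : probability T R).
Context (y : T -> R).
Hypothesis my : measurable_fun setT y.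

(** All the derivatives at [t] of the map sending [t] to [cos (t y)], up to
    sign. *)
Definition same_trig (t : R) : Prop :=
  forall m, same_int mu nu (fun x => y x ^+ m * trig (odd m) (t * y x)).

(** The partial sums of the Taylor expansion at [t y] are dominated by
    [2 |y| ^ m * exp (r |y|)], and [|y| ^ m] is itself at most a multiple of
    [exp (r |y|)]. The radius [r] does not depend on [t]. *)
Lemma same_trig_shift (r t h : R) : 0 < r -> `|h| <= r ->
  mu.-integrable setT (EFin \o (fun x => expR (2 * r * `|y x|))) ->
  nu.-integrable setT (EFin \o (fun x => expR (2 * r * `|y x|))) ->
  same_trig t -> same_trig (t + h).
Proof.
move=> r0 hr imu inu st m.
pose C := 2 * (m`!%:R / r ^+ m).
apply: (@same_int_cvg _ _ _ _ _
  (fun n x => y x ^+ m * series (taylor (odd m) (t * y x) (h * y x)) n) _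
  (fun x => C * expR (2 * r * `|y x|))).
- move=> n; have := same_int_sum (index_iota 0 n)
    (fun j => same_intZ (taylor_cst m j h) (st (m + j)%N)).
  apply: eq_same_int => x; rewrite /series/= mulr_sumr.
  by apply: eq_bigr => j _; rewrite taylorE.
- by move=> x; rewrite mulrDl; apply: cvgMr; exact: cvg_taylor.
- move=> n x; rewrite normrM normrX.
  have y0 := normr_ge0 (y x).
  have rm : 0 < r ^+ m by rewrite exprn_gt0.
  have h1 : `|y x| ^+ m <= m`!%:R / r ^+ m * expR (r * `|y x|).
    rewrite mulrAC ler_pdivlMr// -exprMn (mulrC `|y x|).
    by rewrite exprn_le_expR// mulr_ge0// ltW.
  have h2 : `|series (taylor (odd m) (t * y x) (h * y x)) n| <=
      2 * expR (r * `|y x|).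
    apply: le_trans (taylor_le _ _ _ _) _.
    by rewrite ler_wpM2l// ler_expR normrM ler_wpM2r.
  apply: le_trans (ler_pM _ _ h1 h2) _ => //.
  have -> : 2 * r * `|y x| = r * `|y x| + r * `|y x| by ring.
  by rewrite expRD /C le_eqVlt; apply/orP; left; apply/eqP; ring.
- exact: (integrableZl measurableT C imu).
- exact: (integrableZl measurableT C inu).
Qed.

Lemma same_trig_all (r : R) : 0 < r ->
  mu.-integrable setT (EFin \o (fun x => expR (2 * r * `|y x|))) ->
  nu.-integrable setT (EFin \o (fun x => expR (2 * r * `|y x|))) ->
  same_trig 0 -> forall t, same_trig t.
Proof.
move=> r0 imu inu st0 t.
(* n equal steps of length |t| / n <= r lead from 0 to t. *)
pose n := `|Num.ceil (`|t| / r)|.+1.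
have n0 : 0 < n%:R :> R by rewrite ltr0n.
have step k : same_trig (k%:R * (t / n%:R)).
  elim: k => [|k IH]; first by rewrite mul0r.
  rewrite -natr1 mulrDl mul1r; apply: (same_trig_shift r0) => //.
  rewrite normrM normfV (ger0_norm (ltW n0)) ler_pdivrMr//.
  rewrite mulrC -ler_pdivrMr//.
  apply: (@le_trans _ _ (Num.ceil (`|t| / r))%:~R); first exact: ceil_ge.
  by rewrite /n -natr1 natr_absz ler_wpDr// ler_int ler_norm.
by have := step n; rewrite mulrCA divff ?mulr1// gt_eqF.
Qed.

(** The stronger claim with an extra factor [cos (s y)] goes through by
    induction, using [2 cos x cos y = cos (x + y) + cos (x - y)]. *)
Lemma same_int_cosX (t : R) (n : nat) : (forall s, same_trig s) ->
  same_int mu nu (fun x => cos (t * y x) ^+ n).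
Proof.
move=> H.
suff {n} : forall (n : nat) s,
    same_int mu nu (fun x => cos (t * y x) ^+ n * cos (s * y x)).
  move=> /(_ n 0); apply: eq_same_int => x.
  by rewrite mul0r cos0 mulr1.
elim=> [|n IH] s.
  apply: eq_same_int (H s 0%N) => x; by rewrite !expr0.
apply: eq_same_int (same_intZ 2^-1 (same_intD (IH (s + t)) (IH (s - t)))) => x.
by rewrite !mulrDl mulNr cosD cosB exprSr; field.
Qed.

(** The threshold [c = cos (t b)] separates [|y| < b] from [|y| >= b] as soon as
    [t |y|] and [t b] are at most [pi]; for each point this holds for all small
    [t], so the indicators along [t = 1 / (n + 1)] are eventually constant. *)
Lemma same_measure_ball (K b : R) : 0 < K -> 0 < b ->
  (forall k, (\int[mu]_x (y x ^+ k.*2)%:E <= (K ^+ k.*2 * k.*2`!%:R)%:E)%E) ->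
  (forall k, (\int[nu]_x (y x ^+ k.*2)%:E = \int[mu]_x (y x ^+ k.*2)%:E)%E) ->
  mu [set x | `|y x| < b] = nu [set x | `|y x| < b].
Proof.
move=> K0 b0 mom eqmom.
have momn k : (\int[nu]_x (y x ^+ k.*2)%:E <= (K ^+ k.*2 * k.*2`!%:R)%:E)%E.
  by rewrite eqmom.
pose r := (4 * K)^-1.
have r0 : 0 < r by rewrite invr_gt0 mulr_gt0.
have rK : 2 * r * K <= 2^-1.
  rewrite le_eqVlt; apply/orP; left; apply/eqP.
  by rewrite /r; field; rewrite gt_eqF.
have r20 : 0 < 2 * r by rewrite mulr_gt0.
have imu := integrable_expR_norm my K0 mom r20 rK.
have inu := integrable_expR_norm my K0 momn r20 rK.
have st0 : same_trig 0.
  move=> m; case: (boolP (odd m)) => om.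
    apply: eq_same_int (same_int_cst _ _ 0) => x.
    by rewrite /trig mul0r sin0 mulr0.
  have mE : m = (m./2).*2 by rewrite even_halfK.
  suff : same_int mu nu (fun x => y x ^+ m).
    by apply: eq_same_int => x; rewrite /trig mul0r cos0 mulr1.
  have int (m' : probability T R) :
      (\int[m']_x (y x ^+ m)%:E <= (K ^+ m * m`!%:R)%:E)%E ->
      m'.-integrable setT (EFin \o (fun x => y x ^+ m)).
    move=> h; apply/integrableP; split.
      by apply/measurable_EFinP; exact: measurable_funX.
    under eq_integral do rewrite /= ger0_norm ?exprn_even_ge0//.
    exact: le_lt_trans h (ltry _).
  split.
  - by apply: int; have := mom m./2; rewrite -mE.
  - by apply: int; have := momn m./2; rewrite -mE.
  - by have := eqmom m./2; rewrite -mE => ->.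
have stt := same_trig_all r0 imu inu st0.
have thr (t : R) : same_int mu nu (fun x => (cos (t * b) < cos (t * y x))%R%:R).
  apply: (@same_int_threshold _ _ _ _ _ (fun x => cos (t * y x))).
  - by move=> x; exact: cos_max.
  - exact: cos_max.
  - by move=> n; exact: same_int_cosX.
have mA : measurable [set x | `|y x| < b].
  rewrite -[X in measurable X]setTI.
  by apply: measurable_fun_ltr => //; exact: measurableT_comp.
apply: same_int_measure => //.
apply: (@same_int_cvg _ _ _ _ _
  (fun n x => (cos (harmonic n * b) < cos (harmonic n * y x))%R%:R) _ (cst 1)).
- by move=> n; exact: thr.
- move=> x; apply: cvg_near_cst.
  have small (M : R) : 0 <= M -> \forall n \near \oo, harmonic n * M <= pi :> R.
    move=> M0.
    have : (fun n => harmonic n * M) @ \oo --> (0 : R).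
      by rewrite -[X in _ --> X](mul0r M); apply: cvgMl; exact: cvg_harmonic.
    by move/cvgr_le; apply; exact: pi_gt0.
  near=> n.
  have h0 : 0 < harmonic n :> R by exact: harmonic_gt0.
  rewrite -(cos_norm (_ * y x)) normrM (gtr0_norm h0) ltr_cos.
  - rewrite ltr_pM2l// indicE; congr (nat_of_bool _)%:R.
    by apply/idP/idP => [|/set_mem//]; exact: mem_set.
  - rewrite in_itv/= mulr_ge0 ?(ltW h0)//=.
    by near: n; exact: (small _ (normr_ge0 (y x))).
  - rewrite in_itv/= mulr_ge0 ?(ltW h0) ?(ltW b0)//=.
    by near: n; exact: (small _ (ltW b0)).
- by move=> n x; case: (_ < _); rewrite /= ?normr1 ?normr0.
- exact: finite_measure_integrable_cst.
- exact: finite_measure_integrable_cst.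
Unshelve. all: by end_near. Qed.

End SymmetricDeterminacy.

(** * Determinacy on the half-line *)

Section StieltjesDeterminacy.
Context (R : realType) (mu nu : probability R R) (K : R).
Hypothesis K0 : 0 < K.
Hypothesis mu_ge0 : {ae mu, forall x, 0 <= x}.
Hypothesis nu_ge0 : {ae nu, forall x, 0 <= x}.

(** [same_measure_ball] for [y = sqrt x], whose even moments are the moments of
    [x], gives the rays below positive numbers; the other rays are null. *)
Lemma stieltjes_determinacy :
  (forall k, (\int[mu]_x (x ^+ k)%:E <= (K ^+ k.*2 * k.*2`!%:R)%:E)%E) ->
  (forall k, (\int[nu]_x (x ^+ k)%:E = \int[mu]_x (x ^+ k)%:E)%E) ->
  forall A, measurable A -> nu A = mu A.
Proof.
move=> mom eqmom.
have msqrt : measurable_fun setT (@Num.sqrt R).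
  by apply: continuous_measurable_fun; exact: sqrt_continuous.
have sqrtE (m : probability R R) k : {ae m, forall x, 0 <= x} ->
    (\int[m]_x (Num.sqrt x ^+ k.*2)%:E = \int[m]_x (x ^+ k)%:E)%E.
  move=> m0; apply: ae_eq_integral => //.
  - by apply/measurable_EFinP; exact: measurable_funX.
  - by apply/measurable_EFinP; exact: exprn_measurable.
  - by apply: filterS m0 => x x0 _; rewrite -mul2n exprM sqr_sqrtr.
have ray (b : R) : 0 < b ->
    mu `]-oo, (b ^+ 2)%R[%classic = nu `]-oo, (b ^+ 2)%R[%classic.
  move=> b0.
  have -> : `]-oo, (b ^+ 2)%R[%classic = [set x | `|Num.sqrt x| < b].
    apply/seteqP; split => x /=; rewrite in_itv/= ger0_norm ?sqrtr_ge0//.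
      move=> xb; rewrite -[ltRHS]ger0_norm ?(ltW b0)// -sqrtr_sqr ltr_sqrt//.
      by rewrite exprn_gt0.
    rewrite -[X in _ < X -> _]ger0_norm ?(ltW b0)// -sqrtr_sqr ltr_sqrt//.
    by rewrite exprn_gt0.
  apply: (@same_measure_ball _ _ _ mu nu _ msqrt K) => // k; rewrite !sqrtE//.
have ray0 (m : probability R R) c : {ae m, forall x, 0 <= x} -> c <= 0 ->
    m `]-oo, c[%classic = 0%E.
  move=> m0 c0; apply/eqP; rewrite eq_le measure_ge0 andbT.
  have [N [mN N0 sub]] := m0.
  rewrite -N0 le_measure ?inE//.
  apply: subset_trans sub => x /=; rewrite in_itv/= => xc.
  by apply/negP; rewrite -ltNge (lt_le_trans xc).
apply: (@measure_unique _ _ _ (@RGenInftyO.G R) (fun n => `]-oo, n%:R[%classic)).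
- exact: RGenInftyO.measurableE.
- move=> _ _ [a ->] [b ->]; exists (Num.min a b).
  apply/seteqP; split => x /=; rewrite !in_itv/= lt_min.
    by move=> [-> ->].
  by move/andP.
- by move=> n; exists n%:R.
- apply/seteqP; split => // x _; exists (`|Num.floor x|.+1) => //=.
  rewrite in_itv/= (lt_le_trans (floorD1_gt x))//.
  by rewrite intrD -natr1 lerD2r natr_absz ler_int ler_norm.
- move=> _ [c ->]; have [c0|c0] := leP c 0.
    by have h := etrans (ray0 nu c nu_ge0 c0) (esym (ray0 mu c mu_ge0 c0)); exact h.
  have h := ray _ (etrans (sqrtr_gt0 c) c0).
  rewrite (sqr_sqrtr (ltW c0)) in h; exact (esym h).
- by move=> n; exact: le_lt_trans (probability_le1 _ _) (ltry _).
Qed.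

End StieltjesDeterminacy.

(** * Expectation of a product of independent variables *)

Section IndependentProduct.
Context d (T : measurableType d) (R : realType) (P : probability T R).
Import HBNNSimple.

Let measurable_comp_RV (X : {RV P >-> R}) (f : R -> R) :
  measurable_fun setT f -> measurable_fun setT (fun t => f (X t)).
Proof. by move=> mf; exact: (measurableT_comp mf). Qed.

(** Restricting to values that are reached keeps all the coefficients
    nonnegative, as the integration rules for nonnegative functions require. *)
Let nnsfun_levels (g : {nnsfun R >-> R}) : exists s : seq R,
  (forall r, r \in s -> 0 <= r) /\
  forall x, g x = \sum_(i < size s) s`_i * \1_(g @^-1` [set s`_i]) x.
Proof.
have /finite_seqP[s sE] : finite_set (range g) by exact: fimfunP.
exists (undup s); split => [r|x].
  rewrite mem_undup => rs; have : range g r by rewrite sE.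
  by move=> [x _ <-].
rewrite -(big_mkord predT (fun i => (undup s)`_i * \1_(g @^-1` [set (undup s)`_i]) x)).
rewrite -(big_nth 0 predT (fun r => r * \1_(g @^-1` [set r]) x)).
have gs : g x \in undup s.
  by rewrite mem_undup; have : range g (g x) by []; rewrite sE.
rewrite (bigD1_seq (g x)) ?undup_uniq//= indicE mem_set// mulr1 big1 ?addr0//.
by move=> r rg; rewrite indicE memNset ?mulr0// => /= h; rewrite h eqxx in rg.
Qed.

Let integral_simple (X : {RV P >-> R}) (W : T -> R) (g : {nnsfun R >-> R})
    (s : seq R) :
  (forall r, r \in s -> 0 <= r) ->
  (forall x, g x = \sum_(i < size s) s`_i * \1_(g @^-1` [set s`_i]) x) ->
  measurable_fun setT W -> (forall t, 0 <= W t) ->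
  (\int[P]_t (g (X t) * W t)%:E = \sum_(i < size s)
     (s`_i)%:E * \int[P]_t (\1_(g @^-1` [set s`_i]) (X t) * W t)%:E)%E.
Proof.
move=> s_ge0 gE mW W0.
have s0 (i : 'I_(size s)) : 0 <= s`_i by apply: s_ge0; exact: mem_nth.
have mt (i : 'I_(size s)) :
    measurable_fun setT (fun t => \1_(g @^-1` [set s`_i]) (X t) * W t : R).
  apply: measurable_funM => //.
  apply: (measurable_comp_RV X (f := \1_(g @^-1` [set s`_i]))).
  exact: measurable_indic.
under eq_integral do rewrite gE mulr_suml -sumEFin.
rewrite ge0_integral_sum//.
- apply: eq_bigr => i _; rewrite -ge0_integralZl//.
  + by apply: eq_integral => t _; rewrite -EFinM mulrA.
  + exact/measurable_EFinP.
  + by move=> t _; rewrite lee_fin mulr_ge0.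
  + by rewrite lee_fin.
- move=> i; apply/measurable_EFinP.
  under eq_fun do rewrite -mulrA.
  by apply: measurable_funM; [exact: measurable_cst|exact: mt].
- by move=> i t _; rewrite lee_fin !mulr_ge0.
Qed.

(** A factorization valid for all indicators of events [X \in A] extends to
    nonnegative functions of [X], through simple functions and monotone
    convergence; [c] is the integral of [W] when [W] is independent of [X]. *)
Let integral_mul_indic (X : {RV P >-> R}) (W : T -> R) (c : \bar R) :
  measurable_fun setT W -> (forall t, 0 <= W t) -> c \is a fin_num -> (0 <= c)%E ->
  (forall A, measurable A ->
    (\int[P]_t (\1_A (X t) * W t)%:E = P (X @^-1` A) * c)%E) ->
  forall f : R -> R, measurable_fun setT f -> (forall x, 0 <= f x) ->
  (\int[P]_t (f (X t) * W t)%:E = \int[P]_t (f (X t))%:E * c)%E.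
Proof.
move=> mW W0 cfin c0 H f mf f0.
have mEf : measurable_fun setT (EFin \o f) by exact/measurable_EFinP.
pose h := nnsfun_approx measurableT mEf.
have hcvg (V : T -> R) : measurable_fun setT V -> (forall t, 0 <= V t) ->
    (fun n => \int[P]_t (h n (X t) * V t)%:E)%E @ \oo -->
    (\int[P]_t (f (X t) * V t)%:E)%E.
  move=> mV V0.
  have -> : (\int[P]_t (f (X t) * V t)%:E =
      \int[P]_t limn (fun n => (h n (X t) * V t)%:E))%E.
    apply: eq_integral => t _; apply/esym/cvg_lim => //.
    under eq_fun do rewrite EFinM.
    rewrite EFinM; apply: cvgeZr => //.
    by apply: (cvg_nnsfun_approx measurableT mEf) => // x _; rewrite lee_fin.
  apply: cvg_monotone_convergence => //.
  - move=> n; apply/measurable_EFinP/measurable_funM => //.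
    by apply: measurable_comp_RV; exact: measurable_funP.
  - by move=> n t _; rewrite lee_fin mulr_ge0.
  - move=> t _ n m nm; rewrite lee_fin ler_wpM2r//.
    exact/lefP/(nd_nnsfun_approx measurableT mEf).
have := hcvg W mW W0.
have one0 (t : T) : 0 <= (1 : R) by [].
have hE n : (\int[P]_t (h n (X t) * W t)%:E = \int[P]_t (h n (X t) * 1)%:E * c)%E.
  have [s [s0 gE]] := nnsfun_levels (h n).
  have E1 := @integral_simple X (fun=> 1) (h n) s s0 gE (measurable_cst (1 : R)) one0.
  have mh r : measurable (h n @^-1` [set r]) by exact: measurable_sfunP.
  have I1 r : (\int[P]_t (\1_(h n @^-1` [set r]) (X t) * 1)%:E)%E =
      P (X @^-1` (h n @^-1` [set r])).
    rewrite -[in RHS](setIT (X @^-1` _)) -integral_indic//=.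
      by apply: eq_integral => t _; rewrite mulr1 !indicE.
    by rewrite -[X in measurable X]setTI; exact: measurable_funP.
  rewrite (integral_simple X s0 gE)// E1 ge0_sume_distrl.
    by apply: eq_bigr => i _; rewrite H// I1 muleA.
  move=> i _; rewrite I1 mule_ge0// lee_fin.
  by apply: s0; exact: mem_nth.
under eq_fun do rewrite hE.
have h1 := hcvg _ (measurable_cst (1 : R)) one0.
move=> hW; apply: (cvg_unique _ hW) => //.
have -> : (\int[P]_t (f (X t))%:E)%E = (\int[P]_t (f (X t) * cst 1 t)%:E)%E.
  by apply: eq_integral => t _; rewrite mulr1.
by apply: cvgeZr.
Qed.

(** When every [f i] is an indicator this is the definition of independence.
    The indicators are then replaced by general functions one index at a time:
    [s] lists the indices already treated, and [integral_mul_indic] performs one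
    replacement with [W] the product of all the other factors. *)
Lemma expectation_prod (I : finType) (X : I -> {RV P >-> R}) (f : I -> R -> R) :
  mutually_independent X ->
  (forall i, measurable_fun setT (f i)) -> (forall i x, 0 <= f i x) ->
  (forall i, (\int[P]_t (f i (X i t))%:E)%E \is a fin_num) ->
  (\int[P]_t (\prod_i f i (X i t))%:E = \prod_i \int[P]_t (f i (X i t))%:E)%E.
Proof.
move=> indep mf f0 ffin.
have mA_ (i : I) A : measurable A -> measurable (X i @^-1` A).
  by move=> mA; rewrite -[X in measurable X]setTI; exact: measurable_funP.
have int1 (i : I) A : measurable A ->
    (\int[P]_t (\1_A (X i t))%:E)%E = P (X i @^-1` A).
  move=> mA; rewrite -[in RHS](setIT (X i @^-1` A)) -integral_indic//; last exact: mA_.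
suff gen (s : seq I) : forall f : I -> R -> R,
    (forall i, measurable_fun setT (f i)) -> (forall i x, 0 <= f i x) ->
    (forall i, (\int[P]_t (f i (X i t))%:E)%E \is a fin_num) ->
    (forall i, i \notin s -> exists2 A, measurable A & f i = \1_A) ->
    (\int[P]_t (\prod_i f i (X i t))%:E = \prod_i \int[P]_t (f i (X i t))%:E)%E.
  by apply: (gen (index_enum I) f mf f0 ffin) => i; rewrite mem_index_enum.
elim: s => [|i0 s IH] {mf f0 ffin}f mf f0 ffin fs.
  have /choice[A AP] : forall i, exists A, measurable A /\ f i = \1_A.
    by move=> i; have [A mA fA] := fs i isT; exists A.
  have := indep [set: I]%SET A (fun i => (AP i).1).
  have -> : [set` [set: I]%SET] = setT.
    by apply/seteqP; split => // i _ /=; rewrite finset.in_setT.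
  under eq_bigl do rewrite finset.in_setT.
  move=> indepA; transitivity (P (\bigcap_(i in [set: I]) (X i @^-1` A i))).
    rewrite -[in RHS](setIT (\bigcap_(i in _) _)) -integral_indic//; last first.
      apply: fin_bigcap_measurable => // i _; apply: mA_; exact: (AP i).1.
    apply: eq_integral => t _; congr EFin.
    rewrite indicE; under eq_bigr do rewrite (AP _).2 indicE.
    case: (boolP (t \in _)) => [/set_mem tA|tA].
      by rewrite big1// => i _; rewrite mem_set//; exact: tA.
    have [i tAi] : exists i, ~ A i (X i t).
      by apply/existsNP => h; move/negP: tA; apply; apply/mem_set => i _; exact: h.
    by rewrite (bigD1 i)//= memNset ?mul0r.
  rewrite indepA; apply: eq_bigr => i _; rewrite (AP i).2 int1//; exact: (AP i).1.
pose W t := \prod_(i | i != i0) f i (X i t).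
pose c := (\prod_(i | i != i0) \int[P]_t (f i (X i t))%:E)%E.
have mW : measurable_fun setT W.
  rewrite /W; under eq_fun do rewrite -big_filter.
  apply: (measurable_prod (h := fun i t => f i (X i t))) => i _.
  exact: measurable_comp_RV.
have W0 t : 0 <= W t by apply: prodr_ge0.
have cfin : c \is a fin_num.
  by rewrite /c; elim/big_ind : _ => // x y; exact: fin_numM.
have c0 : (0 <= c)%E.
  by apply: prode_ge0 => i _; apply: integral_ge0 => t _; rewrite lee_fin.
rewrite [RHS](bigD1 i0)//=.
have := @integral_mul_indic (X i0) W c mW W0 cfin c0 _ (f i0) (mf i0) (f0 i0).
rewrite -/c => <-.
  by apply: eq_integral => t _; rewrite (bigD1 i0).
move=> A mA.
pose g j := if j == i0 then \1_A else f j.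
have -> : (\int[P]_t (\1_A (X i0 t) * W t)%:E = \int[P]_t (\prod_i g i (X i t))%:E)%E.
  apply: eq_integral => t _; rewrite (bigD1 i0)//= /g eqxx; congr (EFin (_ * _)).
  by apply: eq_bigr => i /negPf ->.
rewrite IH /g.
- rewrite (bigD1 i0)//= eqxx int1//; congr (_ * _)%E.
  by apply: eq_bigr => i /negPf ->.
- by move=> i; case: eqP => // _; exact: measurable_indic.
- by move=> i x; case: eqP => // _.
- move=> i; case: eqP => // _; rewrite int1//.
  by rewrite fin_num_measure//; exact: mA_.
- move=> j js; case: eqP => [_|/eqP ji]; first by exists A.
  by apply: fs; rewrite inE negb_or ji.
Qed.

End IndependentProduct.

(** * Growth of moments and the Carleman series *)

Section MomentGrowth.
Context (R : realType).

(** The asymptotic bound holds from some [k0] on. Since [(k + 1) ^ p >= 1], a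
    constant that also exceeds the sum of the first [k0] ratios serves for
    every [k]. *)
Lemma growth_of_ratio (m : nat -> R) (p : R) : 0 <= p -> m 0%N = 1 ->
  (forall k, 0 < m k) ->
  ((fun k : nat => m k.+1 / m k) : nat -> R^o)
    =O_\oo ((fun k : nat => k.+1%:R `^ p) : nat -> R^o) ->
  exists2 C : R, 1 <= C & forall k, m k <= C ^+ k * k`!%:R `^ p.
Proof.
move=> p0 m0 mgt /eqO_exP[M M0 [k0 _ HM]].
have r0 k : 0 <= m k.+1 / m k by rewrite divr_ge0// ltW.
have pow1 k : 1 <= k.+1%:R `^ p :> R.
  by rewrite -[leLHS](powRr0 k.+1%:R) ler_powR// ler1n.
have S0 : 0 <= \sum_(k < k0) m k.+1 / m k by exact: sumr_ge0.
pose C := 1 + M + \sum_(k < k0) m k.+1 / m k.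
have C1 : 1 <= C by rewrite /C -addrA lerDl addr_ge0// ltW.
have ratio k : m k.+1 / m k <= C * k.+1%:R `^ p.
  have [kk|kk] := leqP k0 k.
    have := HM k kk; rewrite /= !ger0_norm ?powR_ge0// => /le_trans; apply.
    by rewrite ler_wpM2r ?powR_ge0// /C -addrA addrCA lerDl addr_ge0.
  apply: (@le_trans _ _ (\sum_(k < k0) m k.+1 / m k)).
    by rewrite (bigD1 (Ordinal kk))//= lerDl sumr_ge0.
  apply: (@le_trans _ _ C); first by rewrite /C lerDr addr_ge0// ltW.
  by rewrite ler_peMr// (le_trans ler01).
exists C => //; elim=> [|k IH]; first by rewrite m0 expr0 fact0 powR1 mulr1.
rewrite exprS factS natrM powRM//.
have := ratio k; rewrite ler_pdivrMr// => /le_trans; apply.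
rewrite mulrACA ler_wpM2l//.
by rewrite mulr_ge0 ?powR_ge0// (le_trans ler01).
Qed.

Lemma growth_exprn (m : nat -> R) (C p : R) (N : nat) :
  1 <= C -> 0 <= p -> p * N%:R <= 2 -> (forall k, 0 < m k) ->
  (forall k, m k <= C ^+ k * k`!%:R `^ p) ->
  forall k, m k ^+ N <= (C ^+ N) ^+ k * k`!%:R ^+ 2.
Proof.
move=> C1 p0 pN m0 H k.
have C0 : 0 <= C by rewrite (le_trans ler01).
have f1 : 1 <= k`!%:R :> R by rewrite ler1n fact_gt0.
apply: (@le_trans _ _ ((C ^+ k * k`!%:R `^ p) ^+ N)).
  by rewrite lerXn2r// ?nnegrE ?mulr_ge0 ?exprn_ge0 ?powR_ge0// ltW.
rewrite exprMn -exprM mulnC exprM ler_wpM2l ?exprn_ge0//.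
rewrite -(powR_mulrn N (powR_ge0 _ _)) -powRrM -(powR_mulrn 2 (ler0n _ _)).
by rewrite ler_powR.
Qed.

Lemma sqr_fact_le k : (k`! ^ 2 <= k.*2`!)%N.
Proof.
rewrite -addnn -(bin_fact (leq_addr k k)) addnK -mulnn.
by rewrite leq_pmull// bin_gt0 leq_addr.
Qed.

Lemma fact_le_exp k : (k`! <= k ^ k)%N.
Proof.
elim: k => // k IH; rewrite factS expnS leq_mul2l /=.
by apply: (leq_trans IH); case: k {IH} => // k; rewrite leq_exp2r.
Qed.

(** Since [k! <= k ^ k] and [D >= 1], the [k]-th moment is at most
    [(D k) ^ (2 k)], so the general term is at least [1 / (D k)]. *)
Lemma carleman_series (m : nat -> R) (D : R) : 1 <= D -> (forall k, 0 < m k) ->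
  (forall k, m k <= D ^+ k * k`!%:R ^+ 2) ->
  (\sum_(1 <= k <oo) (m k `^ (- (1 / (2 * k%:R))))%:E = +oo)%E.
Proof.
move=> D1 m0 H.
have D0 : 0 < D by rewrite (lt_le_trans ltr01).
set e := fun k : nat => (m k `^ (- (1 / (2 * k%:R))))%:E.
have term k : (0 < k)%N -> (D * k%:R)^-1 <= m k `^ (- (1 / (2 * k%:R))).
  move=> k0; have kR : 0 < k%:R :> R by rewrite ltr0n.
  have Dk0 : 0 < D * k%:R by rewrite mulr_gt0.
  have le : m k <= (D * k%:R) ^+ (2 * k).
    apply: le_trans (H k) _; rewrite exprMn; apply: ler_pM.
    - by rewrite exprn_ge0// ltW.
    - by rewrite exprn_ge0.
    - by rewrite ler_weXn2l// leq_pmull.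
    - rewrite mulnC exprM lerXn2r ?nnegrE ?exprn_ge0//.
      by rewrite -natrX ler_nat fact_le_exp.
  have -> : (D * k%:R)^-1 = ((D * k%:R) ^+ (2 * k)) `^ (- (1 / (2 * k%:R))).
    rewrite -powR_mulrn ?(ltW Dk0)// -powRrM -powR_inv1 ?(ltW Dk0)//.
    by congr (_ `^ _); rewrite natrM; field; rewrite gt_eqF.
  rewrite !powRN lef_pV2 ?posrE ?powR_gt0 ?exprn_gt0//.
  by rewrite ge0_ler_powR// ?nnegrE ?(ltW (m0 k)) ?exprn_ge0 ?(ltW Dk0)// divr_ge0.
have e0 k : (0 <= e k)%E by rewrite lee_fin powR_ge0.
apply/eqP; apply: contrapT => /negP hfin.
have lt : (\sum_(1 <= k <oo) e k < +oo)%E by rewrite ltey.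
have ge : (0 <= \sum_(1 <= k <oo) e k)%E by apply: nneseries_ge0.
set l := (\sum_(1 <= k <oo) e k)%E in lt ge.
have lf : l \is a fin_num by rewrite ge0_fin_numE.
apply: (@dvg_harmonic R); apply: nondecreasing_is_cvgn.
  by apply: nondecreasing_series => i _ _; exact: harmonic_ge0.
exists (D * fine l) => _ [n _ <-].
rewrite -ler_pdivrMl// mulr_sumr -lee_fin (fineK lf).
apply: (@le_trans _ _ (\sum_(1 <= k < n.+1) e k)%E).
  rewrite -sumEFin big_add1/=; apply: lee_sum => i _.
  by rewrite lee_fin -invfM; exact: term.
rewrite /l; by apply: nneseries_lim_ge => i _ _; exact: e0.
Qed.

End MomentGrowth.

(** * Moments of nonnegative variables *)

Section NonnegativeMoments.
Context d (T : measurableType d) (R : realType) (P : probability T R).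

(** Nonnegativity is only almost sure; absolute values give integrands that are
    nonnegative everywhere, to which the rules for nonnegative functions apply. *)
Lemma moment_norm (X : {RV P >-> R}) k : nonnegative_rv X ->
  moment P X k = (\int[P]_t (`|X t| ^+ k)%:E)%E.
Proof.
move=> X0; rewrite /moment unlock; apply: ae_eq_integral => //.
- by apply/measurable_EFinP; apply: measurable_funX; exact: measurable_funP.
- apply/measurable_EFinP; apply: measurable_funX.
  by apply: measurableT_comp => //; exact: measurable_funP.
- by apply: filterS X0 => t t0 _; rewrite ger0_norm.
Qed.

Lemma moment_distribution (X : {RV P >-> R}) k : nonnegative_rv X ->
  moment P X k = (\int[distribution P X]_x (`|x| ^+ k)%:E)%E.
Proof.
move=> X0; rewrite moment_norm// ge0_integral_distribution//.
by apply/measurable_EFinP; apply: measurable_funX; exact: normr_measurable.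
Qed.

Lemma moment0 (X : {RV P >-> R}) : moment P X 0 = 1%E.
Proof.
rewrite /moment unlock; under eq_integral do rewrite expr0.
by rewrite (integral_cst P measurableT 1%E) mul1e; exact: probability_setT.
Qed.

(** A null moment of positive order would make [X] vanish almost surely. *)
Lemma moment_gt0 (X : {RV P >-> R}) k : nonnegative_rv X ->
  (0 < 'E_P[X])%E -> (0 < moment P X k)%E.
Proof.
move=> X0 EX; case: k => [|k]; first by rewrite moment0 lte01.
rewrite moment_norm// lt_neqAle integral_ge0 ?andbT; last first.
  by move=> t _; rewrite lee_fin exprn_ge0.
apply/eqP => Xk0; move: EX; rewrite unlock.
have mk : measurable_fun setT (fun t => (`|X t| ^+ k.+1)%:E).
  apply/measurable_EFinP; apply: measurable_funX.
  by apply: measurableT_comp => //; exact: measurable_funP.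
have /(ae_eq_integral_abs P measurableT mk) ae0 :
    (\int[P]_t `|(`|X t| ^+ k.+1)%:E|)%E = 0%E.
  rewrite Xk0; apply: eq_integral => t _.
  by rewrite gee0_abs// lee_fin exprn_ge0.
rewrite (ae_eq_integral (cst 0%E)) ?integral0 ?ltxx//.
- by apply/measurable_EFinP; exact: measurable_funP.
- apply: filterS ae0 => t /(_ Logic.I)[/eqP]; rewrite expf_eq0/= normr_eq0.
  by move=> /eqP -> _.
Qed.

(** Expressed through the law, nonnegativity passes to identically distributed
    variables. *)
Lemma nonnegative_distribution (X : {RV P >-> R}) : nonnegative_rv X <->
  distribution P X `]-oo, 0%R[%classic = 0%E.
Proof.
have mA : measurable (X @^-1` `]-oo, 0%R[%classic).
  by rewrite -[X in measurable X]setTI; exact: measurable_funP.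
have E : X @^-1` `]-oo, 0%R[%classic = ~` [set t | 0 <= X t].
  apply/seteqP; split => t /=; rewrite in_itv/= ltNge; first by move/negP.
  by move=> /negP.
split => [[N [mN N0 sub]]|h].
  have : (P (X @^-1` `]-oo, 0%R[%classic) <= P N)%E.
    rewrite le_measure ?inE//; apply: subset_trans sub.
    by move=> t /=; rewrite in_itv/= ltNge => /negP.
  by rewrite N0 measure_le0 => /eqP.
exists (X @^-1` `]-oo, 0%R[%classic); split => //.
by rewrite E; apply: subset_refl.
Qed.

End NonnegativeMoments.

Section ProductMoments.
Context (R : realType) (d : measure_display) (T : measurableType d)
  (P : probability T R) (xi : {RV P >-> R})
  (d' : measure_display) (T' : measurableType d') (P' : probability T' R)
  (N : nat) (xis : 'I_N -> {RV P' >-> R}) (Y : {RV P' >-> R}).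
Hypotheses (xi0 : nonnegative_rv xi) (xifin : finite_moments xi).
Hypotheses (copies : independent_copies xi xis).
Hypothesis YE : forall t, Y t = \prod_(i < N) xis i t.

Lemma nonnegative_copy i : nonnegative_rv (xis i).
Proof.
apply/nonnegative_distribution; rewrite (copies.2 i) ?measurable_itv//.
exact/nonnegative_distribution.
Qed.

Lemma nonnegative_product : nonnegative_rv Y.
Proof.
have : {ae P', forall t i, 0 <= xis i t}.
  by apply: filter_forall => i; exact: nonnegative_copy.
by apply: filterS => t h; rewrite YE prodr_ge0.
Qed.

Lemma moment_copy i k : moment P' (xis i) k = moment P xi k.
Proof.
rewrite !moment_distribution//; last exact: nonnegative_copy.
by apply: eq_measure_integral => A mA _; exact: copies.2.
Qed.

Lemma moment_product k : moment P' Y k = ((fine (moment P xi k)) ^+ N)%:E.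
Proof.
rewrite moment_norm; last exact: nonnegative_product.
have mi i : (\int[P']_t (`|xis i t| ^+ k)%:E)%E = (fine (moment P xi k))%:E.
  rewrite -moment_norm; last exact: nonnegative_copy.
  by rewrite moment_copy fineK// xifin.
transitivity (\int[P']_t (\prod_(i < N) `|xis i t| ^+ k)%:E)%E.
  by apply: eq_integral => t _; rewrite YE normr_prod -prodrXl.
rewrite (expectation_prod (f := fun _ x => `|x| ^+ k) copies.1).
- under eq_bigr do rewrite mi.
  by rewrite prodEFin prodr_const card_ord.
- by move=> _; apply: measurable_funX; exact: normr_measurable.
- by move=> _ x; rewrite exprn_ge0.
- by move=> i; rewrite mi.
Qed.

End ProductMoments.

(** * Determinacy of the product *)

(** Hardy's condition: the bound on the moments of [X] makes the exponential of
    [s * sqrt X] integrable for small [s], and [stieltjes_determinacy] applies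
    to the law of [X]. *)
Lemma hardy_M_det (R : realType) (d : measure_display) (T : measurableType d)
    (P : probability T R) (X : {RV P >-> R}) (K : R) :
  0 < K -> nonnegative_rv X ->
  (forall k, (moment P X k <= (K ^+ k.*2 * k.*2`!%:R)%:E)%E) -> M_det X.
Proof.
move=> K0 X0 mom.
have ae_nonneg (m : probability R R) :
    m `]-oo, 0%R[%classic = 0%E -> {ae m, forall x, 0 <= x}.
  move=> m0; exists `]-oo, 0%R[%classic; split => //.
  by move=> x /= /negP; rewrite -ltNge in_itv.
have dist0 := ae_nonneg (distribution P X) ((nonnegative_distribution X).1 X0).
have distE k : (\int[distribution P X]_x (x ^+ k)%:E)%E = moment P X k.
  rewrite moment_distribution//; apply: ae_eq_integral => //.
  - by apply/measurable_EFinP; exact: exprn_measurable.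
  - by apply/measurable_EFinP; apply: measurable_funX; exact: normr_measurable.
  - by apply: filterS dist0 => x x0 _; rewrite ger0_norm.
split => //.
  move=> k; rewrite ge0_fin_numE; first exact: le_lt_trans (mom k) (ltry _).
  by rewrite moment_norm//; apply: integral_ge0 => t _; rewrite lee_fin exprn_ge0.
move=> nu nu1 numom A mA.
have nu0 : {ae nu, forall x, 0 <= x}.
  apply: ae_nonneg; have -> : `]-oo, (0 : R)[%classic = ~` `[0, +oo[%classic.
    apply/seteqP; split => x /=; rewrite !in_itv/= andbT ltNge; first by move/negP.
    by move=> /negP.
  by rewrite probability_setC// nu1 subee.
apply: (stieltjes_determinacy K0 dist0 nu0) => // k; first by rewrite distE.
by rewrite numom distE.
Qed.

Theorem mainTheorem4 (R : realType) (a : R)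
    (d : measure_display) (T : measurableType d) (P : probability T R)
    (xi : {RV P >-> R})
    (d' : measure_display) (T' : measurableType d') (P' : probability T' R)
    (xis : 'I_`|Num.floor a| -> {RV P' >-> R}) (Y : {RV P' >-> R}) :
  1 <= a ->
  nonnegative_rv xi ->
  finite_moments xi ->
  (0 < 'E_P[xi])%E ->
  independent_copies xi xis ->
  (forall t, Y t = \prod_(i < `|Num.floor a|%N) xis i t) ->
  ((fun k : nat => fine (moment P xi k.+1) / fine (moment P xi k)) : nat -> R^o)
    =O_\oo ((fun k : nat => k.+1%:R `^ (2 / a)) : nat -> R^o) ->
  carleman Y /\ M_det Y.
Proof.
move=> a1 xi0 xifin xipos copies YE ratio.
have a0 : 0 < a by rewrite (lt_le_trans ltr01).
pose m k := fine (moment P xi k).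
have mgt k : 0 < m k.
  by rewrite fine_gt0// moment_gt0//= ltey_eq xifin.
have m0 : m 0%N = 1 by rewrite /m moment0.
have p0 : 0 <= 2 / a by rewrite divr_ge0// ltW.
have pN : 2 / a * `|Num.floor a|%:R <= 2.
  rewrite mulrAC ler_pdivrMr// ler_wpM2l//.
  have f0 : (0 <= Num.floor a)%R by rewrite floor_ge0 ltW.
  rewrite natr_absz ger0_norm//; exact: floor_le_tmp.
have [C C1 mC] := growth_of_ratio p0 m0 mgt ratio.
have momY := moment_product xi0 xifin copies YE.
have Y0 := nonnegative_product xi0 copies YE.
have growth := growth_exprn C1 p0 pN mgt mC.
set N := `|Num.floor a|%N in momY growth.
have D1 : 1 <= C ^+ N by rewrite exprn_ege1.
have D0 : 0 < C ^+ N by rewrite (lt_le_trans ltr01).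
split.
  rewrite /carleman; under eq_eseriesr do rewrite momY.
  exact: (carleman_series D1 (fun k => exprn_gt0 _ (mgt k)) growth).
(* Here K = C ^ N: as it is at least 1, its power k is below its power 2 k. *)
apply: (hardy_M_det D0 Y0) => k; rewrite momY lee_fin.
apply: le_trans (growth k) _; apply: ler_pM.
- by rewrite exprn_ge0// ltW.
- by rewrite exprn_ge0.
- by rewrite ler_weXn2l// -addnn leq_addr.
- by rewrite -natrX ler_nat sqr_fact_le.
Qed.
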